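(* Let $L=\mathbb{F}_{2^n}$ for a positive integer $n$, let $k \geq 2$ be an integer, and let $f(x)=x^{2^{2k}+1}+h(x)\in L[x]$, where $\deg(h)=2^{2k-1}+2$. Write $h(x)=\sum_{j=0}^{2^{2k-1}+2}a_jx^j$. If there is a nonzero coefficient $a_j$ of $h$ such that $\phi_{2^{2k}+1}$ and $\phi_j$ are relatively prime, then the polynomial $$\phi(x,y,z)=\frac{f(x)+f(y)+f(z)+f(x+y+z)}{(x+y)(x+z)(y+z)}$$ is absolutely irreducible.
   Context: For an integer $j\geq 0$, $\phi_j(x,y,z)$ denotes the polynomial $$\phi_j(x,y,z)=\frac{x^j+y^j+z^j+(x+y+z)^j}{(x+y)(x+z)(y+z)} \in \mathbb{F}_2[x,y,z]$$ (in characteristic 2 the denominator divides the numerator; $\phi_j=0$ for $j=0,1,2$). Similarly $\phi$ is a polynomial in $L[x,y,z]$. Two polynomials are relatively prime if they have no nonconstant common factor; for polynomials over $\mathbb{F}_2$ this condition is the same over $\mathbb{F}_2$ and over any extension field. A polynomial over $L$ is absolutely irreducible if it is irreducible over the algebraic closure $\overline{L}$. *)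

(* Defs.v *)
From HB Require Import structures.
From mathcomp Require Import all_boot all_order all_algebra all_field.
From mathcomp Require Import ring.
From mathcomp.multinomials Require Export mpoly.

Set Implicit Arguments.
Unset Strict Implicit.
Unset Printing Implicit Defensive.

Import GRing.Theory.
Local Open Scope ring_scope.

Section Phi.
Variable K : fieldType.

Definition X3 : {mpoly K[3]} := 'X_(@inord 2 0).
Definition Y3 : {mpoly K[3]} := 'X_(@inord 2 1).
Definition Z3 : {mpoly K[3]} := 'X_(@inord 2 2).

Definition subst3 (f : {poly K}) (p : {mpoly K[3]}) : {mpoly K[3]} :=
  (map_poly (@mpolyC 3 K) f).[p].

Definition phi_num (f : {poly K}) : {mpoly K[3]} :=
  subst3 f X3 + subst3 f Y3 + subst3 f Z3 + subst3 f (X3 + Y3 + Z3).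

Definition phi_den : {mpoly K[3]} := (X3 + Y3) * (X3 + Z3) * (Y3 + Z3).

(* Newton's recurrence for x, y, z, x+y+z, whose sum vanishes and whose third
   elementary symmetric function is (x+y)(x+z)(y+z) in characteristic 2. *)
Lemma dvd_power_sum4 (R : comNzRingType) (x y z : R) (j : nat) :
  2 \in [pchar R] ->
  exists q, q * ((x + y) * (x + z) * (y + z)) =
            x ^+ j + y ^+ j + z ^+ j + (x + y + z) ^+ j.
Proof.
move=> char2; have two0 : 2%:R = 0 :> R := pcharf0 char2.
have mod2 (a b c : R) : a = b + 2%:R * c -> a = b by rewrite two0 mul0r addr0.
elim/ltn_ind: j => -[|[|[|[|j]]]] IH.
- exists 0; apply: (mod2 _ _ (- 2%:R)); ring.
- exists 0; apply: (mod2 _ _ (- (x + y + z))); ring.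
- exists 0; apply: (mod2 _ _ (- (x ^+ 2 + y ^+ 2 + z ^+ 2 + x * y + x * z + y * z))); ring.
- exists 1; apply: (mod2 _ _ (- (x ^+ 3 + y ^+ 3 + z ^+ 3 + (x + y) * (x + z) * (y + z)))); ring.
have [q0 e0] := IH j (leq_trans (ltnSn _) (leq_addl 3 _)).
have [q1 e1] := IH j.+1 (leq_trans (ltnSn _) (leq_addl 2 _)).
have [q2 e2] := IH j.+2 (leq_trans (ltnSn _) (leq_addl 1 _)).
pose w := x + y + z.
exists ((x * y + x * z + y * z + (x + y + z) * w) * q2
        + (x + y) * (x + z) * (y + z) * q1 + x * y * z * w * q0).
set D := _ * (y + z) in e0 e1 e2 *.
transitivity ((x * y + x * z + y * z + (x + y + z) * w) * (q2 * D)
              + D * (q1 * D) + x * y * z * w * (q0 * D)); first by rewrite /D; ring.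
rewrite e0 e1 e2 /D !exprS.
set a := x ^+ j; set b := y ^+ j; set c := z ^+ j; set d := (x + y + z) ^+ j.
apply: (mod2 _ _
  ((x * y + x * z + y * z + w * w) *
     (x ^+ 2 * a + y ^+ 2 * b + z ^+ 2 * c + w ^+ 2 * d)
   + x * y * z * w * (a + b + c + d)
   - w * (x ^+ 3 * a + y ^+ 3 * b + z ^+ 3 * c + w ^+ 3 * d)
   - x * y * z * (x * a + y * b + z * c + w * d))).
rewrite /w; ring.
Qed.

Lemma phi_num_div (f : {poly K}) :
  2 \in [pchar K] -> exists q, q * phi_den == phi_num f.
Proof.
move=> char2.
have char2m : 2 \in [pchar {mpoly K[3]}] by rewrite pchar_lalg.
have H j := dvd_power_sum4 X3 Y3 Z3 j char2m.
have {}H j : {q | q * phi_den == X3 ^+ j + Y3 ^+ j + Z3 ^+ j + (X3 + Y3 + Z3) ^+ j}.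
  by apply: sigW; have [q e] := H j; exists q; apply/eqP.
exists (\sum_(j < size f) (f`_j)%:MP * sval (H j)).
rewrite /phi_num /subst3 !horner_coef !size_map_poly.
rewrite -!big_split mulr_suml; apply/eqP/eq_bigr => j _ /=.
by rewrite !coef_map /= -mulrA (eqP (svalP (H j))) !mulrDr.
Qed.

(* The quotient phi_num f / phi_den; the value 0 in characteristic <> 2, where
   the division need not be exact, is a dummy. *)
Definition phi (f : {poly K}) : {mpoly K[3]} :=
  if @idP (2 \in [pchar K]) is ReflectT char2
  then xchoose (phi_num_div f char2) else 0.

Lemma phiP (f : {poly K}) :
  2 \in [pchar K] -> phi f * phi_den = phi_num f.
Proof.
rewrite /phi; case: {-}_ / idP => // char2 _.
exact/eqP/(xchooseP (phi_num_div f char2)).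
Qed.

End Phi.

Definition phi_mono (j : nat) : {mpoly 'F_2[3]} := phi 'X^j.

Lemma phi_monoP (j : nat) :
  phi_mono j * phi_den 'F_2 =
  X3 _ ^+ j + Y3 _ ^+ j + Z3 _ ^+ j + (X3 _ + Y3 _ + Z3 _) ^+ j.
Proof.
by rewrite phiP ?pchar_Fp // /phi_num /subst3 !map_polyXn !hornerXn.
Qed.

Definition relatively_prime (n : nat) (K : fieldType) (p q : {mpoly K[n]}) : Prop :=
  forall d a b : {mpoly K[n]}, p = a * d -> q = b * d -> exists c : K, d = c%:MP.

Definition irreducible_elt (R : idomainType) (p : R) : Prop :=
  [/\ p != 0, p \isn't a GRing.unit &
      forall a b : R, p = a * b -> a \is a GRing.unit \/ b \is a GRing.unit].

(* An algebraic closure of L is an algebraically closed field that is algebraic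
   over L via iota. Quantifying over all of them is harmless, as they are
   isomorphic over L; for finite L, countable_algebraic_closure provides one. *)
Definition absolutely_irreducible (n : nat) (L : fieldType) (p : {mpoly L[n]}) : Prop :=
  forall (Lbar : closedFieldType) (iota : {rmorphism L -> Lbar}),
    integralRange iota -> irreducible_elt (map_mpoly iota p).

(* Main.v *)
From HB Require Import structures.
Require Import Defs.
From mathcomp Require Import all_boot all_order all_algebra all_field.
From mathcomp Require Import ring zify.

(* Write q = 2^(2k). Over an algebraic closure, the leading form G = phi_(q+1) of phi is the
   product of the distinct (projective) lines x - z = a (y - z), for a in F_q \ F_2, and all forms of phi
   of degree strictly between q/2 - 1 and q - 2 vanish. If phi = P Q with deg Q <= deg P,
   then the leading forms of P and Q are coprime, so this gap forces the forms of P and Q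
   following their leading ones to vanish as well.
   If deg Q < q/2 - 1, then Q is a form dividing every a_j phi_j, so one of the lines divides
   phi_j; since phi_(q+1) and phi_j are defined over F_2, the product of the conjugates of
   this line is a common factor over F_2.
   If deg Q = q/2 - 1, then P and Q are their leading forms plus constants. A primitive cube
   root of unity gives a line dividing both G and the form phi_j of degree q/2 - 1, which
   makes one of the constants vanish; then phi_j, hence x + y, divides G, which is absurd. *)

Set Implicit Arguments.
Unset Strict Implicit.
Unset Printing Implicit Defensive.

Import GRing.Theory.
Local Open Scope ring_scope.

(* [upoly p] is [p] as a polynomial in [x - z]: it substitutes ['X + z] for [x]. *)
Definition upoly_var (K : fieldType) (i : 'I_3) : {poly {mpoly K[3]}} :=
  if i == @inord 2 0 then 'X + (Z3 K)%:P else ('X_i)%:P.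

HB.lock Definition upoly (K : fieldType) : {mpoly K[3]} -> {poly {mpoly K[3]}} :=
  mmap (polyC \o @mpolyC 3 K) (@upoly_var K).

(** * Lines through (1:1:1) as factors of ternary polynomials *)

Section Substitution.
Variable K : fieldType.
Local Notation R := {mpoly K[3]}.
Local Notation upoly := (@upoly K).
Local Notation upoly_var := (upoly_var K).

Fact upoly_is_zmod_morphism : zmod_morphism upoly.
Proof. by rewrite unlock; exact: rmorphB. Qed.
Fact upoly_is_monoid_morphism : monoid_morphism upoly.
Proof. by rewrite unlock; split; [exact: rmorph1 | exact: rmorphM]. Qed.
HB.instance Definition _ := GRing.isZmodMorphism.Build R {poly R} upoly upoly_is_zmod_morphism.
HB.instance Definition _ := GRing.isMonoidMorphism.Build R {poly R} upoly upoly_is_monoid_morphism.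

Lemma upolyC c : upoly c%:MP = (c%:MP)%:P.
Proof. by rewrite unlock mmapC. Qed.

Lemma upolyXU i : upoly 'X_i = upoly_var i.
Proof. by rewrite unlock mmapX mmap1U. Qed.

Lemma upolyX3 : upoly (X3 K) = 'X + (Z3 K)%:P.
Proof. by rewrite upolyXU /upoly_var eqxx. Qed.

Lemma upolyY3 : upoly (Y3 K) = (Y3 K)%:P.
Proof. by rewrite upolyXU /upoly_var -val_eqE /= !inordK. Qed.

Lemma upolyZ3 : upoly (Z3 K) = (Z3 K)%:P.
Proof. by rewrite upolyXU /upoly_var -val_eqE /= !inordK. Qed.

Lemma horner_upoly p : (upoly p).[X3 K - Z3 K] = p.
Proof.
elim/mpolyind: p => [|c m p _ _ IH]; first by rewrite rmorph0 horner0.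
have -> := rmorphD upoly (c *: 'X_[m]) p.
rewrite hornerD.
rewrite IH.
rewrite -mul_mpolyC.
rewrite (rmorphM upoly) /= hornerM.
rewrite upolyC hornerC.
congr (_ * _ + _); rewrite mpolyXE_id rmorph_prod horner_prod.
apply: eq_bigr => i _; rewrite rmorphXn /= horner_exp upolyXU /upoly_var.
by case: eqP => [->|_]; rewrite ?hornerD ?hornerX ?hornerC ?subrK.
Qed.

(* The restriction of [p] to the plane [x - z = a (y - z)], keeping [y] and [z]. *)
Definition restr (a : K) (p : R) : R := (upoly p).[a%:MP * (Y3 K - Z3 K)].
HB.instance Definition _ (a : K) :=
  GRing.RMorphism.copy (restr a) (horner_eval (a%:MP * (Y3 K - Z3 K)) \o upoly).

Definition line (a : K) : R := X3 K - Z3 K - a%:MP * (Y3 K - Z3 K).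

Lemma restrC a c : restr a c%:MP = c%:MP.
Proof. by rewrite /restr upolyC hornerC. Qed.
Lemma restrX3 a : restr a (X3 K) = a%:MP * (Y3 K - Z3 K) + Z3 K.
Proof. by rewrite /restr upolyX3 hornerD hornerX hornerC. Qed.
Lemma restrY3 a : restr a (Y3 K) = Y3 K.
Proof. by rewrite /restr upolyY3 hornerC. Qed.
Lemma restrZ3 a : restr a (Z3 K) = Z3 K.
Proof. by rewrite /restr upolyZ3 hornerC. Qed.

Lemma Y3_sub_Z3_neq0 : Y3 K - Z3 K != 0.
Proof.
apply/eqP => /(congr1 (meval (fun i : 'I_3 => (i == inord 1)%:R))) /eqP.
by rewrite mevalB !mevalXU meval0 eqxx -val_eqE /= !inordK // subr0 oner_eq0.
Qed.

Lemma restr_line a b : restr a (line b) = (a - b)%:MP * (Y3 K - Z3 K).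
Proof.
rewrite /line !(rmorphB, rmorphM) /= restrC restrX3 restrY3 restrZ3; ring.
Qed.

Lemma restr_line_eq0 a b : (restr a (line b) == 0) = (a == b).
Proof.
by rewrite restr_line mulf_eq0 (negPf Y3_sub_Z3_neq0) orbF mpolyC_eq0 subr_eq0.
Qed.

Lemma restr_lineK a : restr a (line a) = 0.
Proof. by apply/eqP; rewrite restr_line_eq0. Qed.

(** The factor theorem for [upoly p], a polynomial in x - z, at the point a (y - z). *)
Lemma line_dvdP a p : restr a p = 0 <-> exists r, p = r * line a.
Proof.
split=> [/eqP/factor_theorem [r e]|[r ->]]; last first.
  by rewrite rmorphM /= restr_lineK mulr0.
exists r.[X3 K - Z3 K]; rewrite -{1}[p]horner_upoly e hornerM hornerXsubC.
by rewrite /line.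
Qed.

Lemma line_neq0 a : line a != 0.
Proof.
have: restr (a + 1) (line a) != 0.
  by rewrite restr_line_eq0 -subr_eq0 addrAC subrr add0r oner_eq0.
by apply: contra_neq => ->; rewrite rmorph0.
Qed.

Definition lines (s : seq K) : R := \prod_(a <- s) line a.

Lemma restr_lines_eq0 a s : (restr a (lines s) == 0) = (a \in s).
Proof.
rewrite rmorph_prod prodf_seq_eq0 -has_pred1; apply: eq_has => b /=.
by rewrite restr_line_eq0 eq_sym.
Qed.

Lemma lines_neq0 s : lines s != 0.
Proof. by rewrite prodf_seq_neq0; apply/allP => a _; rewrite /= line_neq0. Qed.

Lemma lines_rem a s : a \in s -> lines s = line a * lines (rem a s).
Proof. by move=> as_; rewrite /lines (perm_big _ (perm_to_rem as_)) big_cons. Qed.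

(** Restriction to a line is a morphism into a domain, so every line is prime: unless one of them
    divides A, all of them cancel against B. *)
Lemma lines_factor A B s :
  A * B = lines s -> (exists2 a, a \in s & restr a A = 0) \/ A \is a GRing.unit.
Proof.
elim: s B => [|a s IH] B; rewrite /lines ?big_nil ?big_cons.
  by move=> e; right; apply/unitrPr; exists B.
move=> e; have /eqP : restr a A * restr a B = 0.
  by rewrite -rmorphM /= e rmorphM /= restr_lineK mul0r.
rewrite mulf_eq0 => /orP[/eqP rA|/eqP/line_dvdP[B' eB]].
  by left; exists a; rewrite ?mem_head.
case: (IH B') => [|[b bs rA]|uA]; last by right.
- by apply: (mulIf (line_neq0 a)); rewrite -mulrA -eB e mulrC.
- by left; exists b; rewrite // inE bs orbT.
Qed.

(** Without repetitions in [s], A and B share no line. The induction strips a line either from A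
    together with D, or from B together with C. *)
Lemma lines_coprime_dvd A B C D s :
  uniq s -> A * B = lines s -> A * C = D * B -> exists E, D = E * A.
Proof.
elim: s A B C D => [|a s IH] A B C D; rewrite /lines ?big_nil ?big_cons.
  move=> _ eAB eACD; exists (D * B).
  by rewrite -mulrA [B * A]mulrC eAB mulr1.
case/andP=> as_ us e eACD.
have ra0 := restr_lineK a.
have /eqP : restr a A * restr a B = 0 by rewrite -rmorphM /= e rmorphM /= ra0 mul0r.
have rs : restr a (lines s) != 0 by rewrite restr_lines_eq0.
rewrite mulf_eq0 => /orP[/eqP/line_dvdP[A' eA]|/eqP/line_dvdP[B' eB]].
- have eAB : A' * B = lines s.
    by apply: (mulIf (line_neq0 a)); rewrite -mulrA [B * _]mulrC mulrA -eA e mulrC.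
  have /eqP : restr a D * restr a B = 0.
    by rewrite -rmorphM /= -eACD eA !rmorphM /= ra0 mulr0 mul0r.
  move: rs; rewrite -eAB rmorphM /= !mulf_eq0 negb_or => /andP[_ /negPf->].
  rewrite orbF => /eqP/line_dvdP[D' eD].
  have [|E ED'] := IH A' B C D' us eAB; last by exists E; rewrite eA eD ED' mulrA.
  by apply: (mulIf (line_neq0 a)); rewrite mulrAC -eA eACD eD mulrAC.
- have eAB : A * B' = lines s.
    by apply: (mulIf (line_neq0 a)); rewrite -mulrA -eB e mulrC.
  have /eqP : restr a A * restr a C = 0.
    by rewrite -rmorphM /= eACD eB !rmorphM /= ra0 !mulr0.
  move: rs; rewrite -eAB rmorphM /= !mulf_eq0 negb_or => /andP[/negPf-> _].
  move=> /eqP/line_dvdP[C' eC].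
  apply: (IH A B' C' D us eAB).
  by apply: (mulIf (line_neq0 a)); rewrite -mulrA -eC eACD eB mulrA.
Qed.

(** A homogeneous form of the factorization of X^q - X. As polynomials in x - z, both sides are
    monic of degree q with the q roots a (y - z), so their difference has more roots than its degree
    allows. *)
Lemma lines_root_expX q s :
  (1 < q)%N -> uniq s -> size s = q -> {in s, forall a, a ^+ q = a} ->
  lines s = (X3 K - Z3 K) ^+ q - (Y3 K - Z3 K) ^+ q.-1 * (X3 K - Z3 K).
Proof.
move=> q_gt1 us ss sq; set u := X3 K - Z3 K; set v := Y3 K - Z3 K.
pose w a := a%:MP * v : R.
pose A : {poly R} := \prod_(b <- map w s) ('X - b%:P).
pose B : {poly R} := 'X^q - v ^+ q.-1 *: 'X.
suff eAB : A = B.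
  have := congr1 (horner^~ u) eAB.
  rewrite /A /B /= hornerD hornerN hornerZ hornerXn hornerX => <-.
  by rewrite big_map horner_prod; apply: eq_bigr => a _; rewrite hornerXsubC.
apply/eqP; rewrite -subr_eq0; apply/negPn/negP => nz.
have w_inj : injective w.
  move=> a b /(mulIf Y3_sub_Z3_neq0) /eqP; rewrite -subr_eq0 -mpolyCB mpolyC_eq0.
  by rewrite subr_eq0 => /eqP.
have rootAB : all (root (A - B)) (map w s).
  apply/allP=> b bs; rewrite /root hornerD hornerN.
  have /eqP-> : root A b by rewrite root_prod_XsubC.
  case/mapP: bs => a /sq aq ->; rewrite /B hornerD hornerN hornerZ hornerXn hornerX.
  rewrite /w exprMn -rmorphXn /= aq.
  by rewrite mulrCA -exprSr prednK 1?ltnW // subrr subr0.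
have := max_poly_roots nz rootAB; rewrite map_inj_uniq // => /(_ us).
rewrite size_map ss ltnNge => /negP; apply; apply/leq_sizeP => j.
have sA : size A = q.+1 by rewrite size_prod_XsubC size_map ss.
rewrite leq_eqVlt coefB coefB coefXn coefZ coefX => /orP[/eqP<-|jq].
  have := monic_prod_XsubC (map w s) xpredT id; rewrite -/A monicE /lead_coef sA => /eqP->.
  by rewrite eqxx gtn_eqF // mulr0 subr0 subrr.
rewrite nth_default ?sA // gtn_eqF // gtn_eqF ?(ltn_trans q_gt1) //.
by rewrite mulr0 subrr subr0.
Qed.

End Substitution.

(** * Homogeneous components and leading forms *)

Section HomogeneousComponents.
Variables (n : nat) (K : fieldType).
Implicit Types p q : {mpoly K[n]}.
Local Notation comp := (@pihomog n K mdeg).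

Lemma pihomog_homog d e p :
  p \is d.-homog -> comp e p = if e == d then p else 0.
Proof.
move=> hp; case: eqP => [->|/eqP]; first exact: pihomog_dE.
by rewrite eq_sym => ne; apply: pihomog_ne0 hp.
Qed.

Lemma mcoeff_pihomog d p (m : 'X_{1..n}) :
  (comp d p)@_m = if mdeg m == d then p@_m else 0.
Proof.
case: eqP => [<-|/eqP ne]; last exact: dhomog_nemf_coeff (pihomogP _ _ _) ne.
rewrite {2}(@pihomog_partitionE _ _ mdeg (maxn (msize p) (mdeg m).+1) p) ?leq_maxl //.
have lt : (mdeg m < maxn (msize p) (mdeg m).+1)%N by rewrite leq_max ltnSn orbT.
rewrite [in RHS]raddf_sum (bigD1 (Ordinal lt)) //= big1 ?addr0 // => i.
rewrite -val_eqE eq_sym /= => ne.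
exact: dhomog_nemf_coeff (pihomogP _ _ _) ne.
Qed.

Lemma pihomog_msize d p : (msize p <= d)%N -> comp d p = 0.
Proof.
move=> le; apply/mpolyP => m; rewrite mcoeff_pihomog mcoeff0.
by case: eqP => // dm; apply/memN_msupp_eq0/msize_mdeg_ge; rewrite dm.
Qed.

Lemma pihomog_lead_neq0 p : p != 0 -> comp (msize p).-1 p != 0.
Proof.
move=> nz; apply: contra_neq (nz) => /(congr1 (mcoeff (mlead p))).
rewrite mcoeff_pihomog mcoeff0 -mlead_deg //= eqxx => /eqP.
by rewrite mleadc_eq0 => /eqP.
Qed.

Lemma msize_pihomog d p : (msize (comp d p) <= d.+1)%N.
Proof.
rewrite leqNgt; apply/negP => lt.
have nz : comp d p != 0 by apply: contraTneq lt => ->; rewrite msize0.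
have : (comp d p)@_(mlead (comp d p)) != 0 by rewrite mleadc_eq0.
rewrite mcoeff_pihomog; case: (mdeg _ =P d) => [e _|_ /eqP//].
by move: lt; rewrite -(mlead_deg nz) e ltnn.
Qed.

Lemma pihomogM_homog d e p q :
  q \is e.-homog -> comp (d + e) (p * q) = comp d p * q.
Proof.
(* The bound also exceeds d, so that the decomposition of p has a summand of degree d even when that
   form is zero. *)
move=> hq; pose k := maxn (msize p) d.+1.
have lt : (d < k)%N by rewrite leq_max ltnSn orbT.
rewrite {1}(@pihomog_partitionE _ _ mdeg k p) ?leq_maxl //.
rewrite mulr_suml raddf_sum (bigD1 (Ordinal lt)) //= big1 ?addr0 => [|i].
  by rewrite (pihomog_homog _ (dhomogM (pihomogP _ _ _) hq)) eqxx.
rewrite -val_eqE eq_sym /= => ne.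
by rewrite (pihomog_homog _ (dhomogM (pihomogP _ _ _) hq)) eqn_add2r (negPf ne).
Qed.

(** For p of degree at most s, this is t^s p(x_1/t, ..., x_n/t) as a polynomial in t: the indices
    count degrees downwards from s. *)
Definition top_down s p : {poly {mpoly K[n]}} := \poly_(i < s.+1) comp (s - i) p.

Lemma sum_pihomog_top s p :
  (msize p <= s.+1)%N -> p = \sum_(i < s.+1) comp (s - i) p.
Proof.
move=> le; rewrite {1}(@pihomog_partitionE _ _ mdeg s.+1 p) //.
by rewrite (reindex_inj rev_ord_inj); apply: eq_bigr => i _ /=; rewrite subSS.
Qed.

Lemma coef_top_downM s t p q k :
  (msize p <= s.+1)%N -> (msize q <= t.+1)%N -> (k <= s + t)%N ->
  (top_down s p * top_down t q)`_k = comp (s + t - k) (p * q).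
Proof.
move=> sp sq kst; rewrite {2}(sum_pihomog_top sp) {2}(sum_pihomog_top sq).
rewrite /top_down !poly_def !mulr_suml raddf_sum coef_sum; apply: eq_bigr => i _.
rewrite !mulr_sumr raddf_sum coef_sum; apply: eq_bigr => j _ /=.
rewrite -scalerAl -scalerAr -exprD !coefZ coefXn.
rewrite (pihomog_homog _ (dhomogM (pihomogP _ _ _) (pihomogP _ _ _))).
(* No subtraction truncates here, since i <= s, j <= t and k <= s + t. *)
have -> : (s + t - k == s - i + (t - j))%N = (k == i + j)%N.
  by have := ltn_ord i; have := ltn_ord j; lia.
by case: eqP; rewrite ?mulr1 ?mulr0.
Qed.

End HomogeneousComponents.

(** * Gaps in a product and in its factors *)

Lemma coefM_gap (R : comNzRingType) (p q : {poly R}) m : (0 < m)%N ->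
  (forall i, (0 < i < m)%N -> p`_i = 0 \/ q`_(m - i) = 0) ->
  (p * q)`_m = p`_0 * q`_m + p`_m * q`_0.
Proof.
case: m => // m _ gap; rewrite coefM big_ord_recl big_ord_recr /= subn0 subnn.
rewrite big1 ?add0r // => i _; have := gap (lift ord0 i).
rewrite /bump /= !add1n ltnS ltn_ord => /(_ isT).
by case=> ->; rewrite ?mul0r ?mulr0.
Qed.

(** At the first index i not yet treated, p_0 q_i + p_i q_0 = 0. As p_0 and q_0 are coprime, p_0
    divides p_i, which would have smaller degree if nonzero; so p_i = 0, and then q_i = 0. *)
Lemma lines_gap (K : fieldType) (p q : {poly {mpoly K[3]}}) (s : seq K) m :
  uniq s -> p`_0 * q`_0 = lines s ->
  (forall i, (0 < i)%N -> p`_i != 0 -> (msize p`_i < msize p`_0)%N) ->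
  (forall i, (0 < i < m)%N -> (p * q)`_i = 0) ->
  forall i, (0 < i < m)%N -> p`_i = 0 /\ q`_i = 0.
Proof.
move=> us epq sz pq0; elim/ltn_ind => i IH im.
have /andP[i0 _] := im.
have := pq0 i im; rewrite coefM_gap // => [e|j /andP[j0 ji]]; last first.
  by left; case: (IH j ji) => //; rewrite j0 (ltn_trans ji) //; case/andP: im.
have [p0 q0] : p`_0 != 0 /\ q`_0 != 0.
  by apply/andP; rewrite -negb_or -mulf_eq0 epq lines_neq0.
have eD : p`_0 * - q`_i = p`_i * q`_0.
  by rewrite mulrN; apply/eqP; rewrite eq_sym -addr_eq0 addrC e.
have [E eE] := lines_coprime_dvd us epq eD.
have pi0 : p`_i = 0.
  apply/eqP; apply: contraT => nz; have := sz i i0 nz.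
  have nzE : E != 0 by apply: contra_neq nz => E0; rewrite eE E0 mul0r.
  by rewrite eE msizeM // (mpolySpred _ nzE) addSn ltnNge leq_addl.
split=> //; move: e; rewrite pi0 mul0r addr0 => /eqP.
by rewrite mulf_eq0 (negPf p0) => /eqP.
Qed.

(** * Extension of the field of coefficients *)

Section ChangeOfField.
Variables (F K : fieldType) (iota : {rmorphism F -> K}).
Local Notation "p ^iota" := (map_mpoly iota p) (at level 2, format "p ^iota").

Lemma map_mpoly_X3 : (X3 F)^iota = X3 K. Proof. exact: map_mpolyX. Qed.
Lemma map_mpoly_Y3 : (Y3 F)^iota = Y3 K. Proof. exact: map_mpolyX. Qed.
Lemma map_mpoly_Z3 : (Z3 F)^iota = Z3 K. Proof. exact: map_mpolyX. Qed.

Lemma map_upoly (p : {mpoly F[3]}) : map_poly (map_mpoly iota) (upoly p) = upoly p^iota.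
Proof.
elim/mpolyind: p => [|c m p _ _ IH]; first by rewrite !rmorph0.
rewrite !rmorphD /= IH -mul_mpolyC !rmorphM /= map_mpolyC !upolyC map_polyC /=.
rewrite map_mpolyC; congr (_ * _ + _).
rewrite map_mpolyX !mpolyXE_id !rmorph_prod; apply: eq_bigr => i _ /=.
rewrite !rmorphXn /=; congr (_ ^+ _); rewrite !upolyXU /upoly_var.
case: eqP => _; rewrite ?rmorphD /= ?map_polyX map_polyC /= ?map_mpoly_Z3 //.
by rewrite map_mpolyX.
Qed.

End ChangeOfField.

(** * Descent of a common line to a common factor over a finite field *)

Section Descent.
Variables (F : finFieldType) (K : fieldType) (iota : {rmorphism F -> K}) (a : K).
Local Notation "p ^iota" := (map_mpoly iota p) (at level 2, format "p ^iota").

(** The minimal polynomial of [a] over F. Polynomials of bounded size form a finite type, so the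
    least size of a nonzero one with root [a] is found by a decidable search. *)
Lemma exists_minpoly (f : {poly F}) :
  f != 0 -> root (map_poly iota f) a ->
  exists m : {poly F}, [/\ m \is monic, root (map_poly iota m) a &
    forall r : {poly F}, (size r < size m)%N -> root (map_poly iota r) a -> r = 0].
Proof.
move=> nzf rf.
pose P d := [exists v : 'rV[F]_d, (rVpoly v != 0) && root (map_poly iota (rVpoly v)) a].
have PP (g : {poly F}) d : (size g <= d)%N -> g != 0 -> root (map_poly iota g) a -> P d.
  by move=> sg nzg rg; apply/existsP; exists (poly_rV g); rewrite poly_rV_K // nzg.
have exP : exists d, P d by exists (size f); exact: (PP f).
case: (ex_minnP exP) => d /existsP[v /andP[nzv rv]] min.
have sd : size (rVpoly v) = d.
  by apply/eqP; rewrite eqn_leq size_poly; apply: min; apply: (PP (rVpoly v)).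
have lc0 : lead_coef (rVpoly v) != 0 by rewrite lead_coef_eq0.
exists ((lead_coef (rVpoly v))^-1 *: rVpoly v); split.
- by rewrite monicE lead_coefZ mulVf.
- by rewrite map_polyZ rootZ // fmorph_eq0 invr_eq0.
move=> r; rewrite size_scale ?invr_eq0 // sd => ltr rr.
apply/eqP; apply: contraTT ltr => nzr; rewrite -leqNgt; apply: min.
exact: (PP r).
Qed.

(** The homogenization v^(deg m) m(u/v) as a polynomial in u, with v = y - z. For monic m its value
    at u = x - z is the product of the lines of the roots of m in a splitting field. *)
Definition homogenized (m : {poly F}) : {poly {mpoly F[3]}} :=
  \poly_(i < size m) ((m`_i)%:MP * (Y3 F - Z3 F) ^+ ((size m).-1 - i)).

Lemma homogenized_root (m : {poly F}) :
  root (map_poly iota m) a ->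
  (map_poly (map_mpoly iota) (homogenized m)).[a%:MP * (Y3 K - Z3 K)] = 0.
Proof.
move=> rm; rewrite (@horner_coef_wide _ (size m)); last first.
  by rewrite (leq_trans (size_poly _ _)) // size_poly.
rewrite (eq_bigr (fun i : 'I_(size m) =>
    (iota m`_i * a ^+ i)%:MP * (Y3 K - Z3 K) ^+ (size m).-1)) => [|i _].
  rewrite -mulr_suml -raddf_sum /=.
  suff -> : \sum_(i < size m) iota m`_i * a ^+ i = 0 by rewrite mul0r.
  rewrite -[RHS](rootP rm) (@horner_coef_wide _ (size m)) ?size_poly //.
  by apply: eq_bigr => i _; rewrite coef_map.
rewrite coef_map coef_poly ltn_ord /= [map_mpoly _ _]rmorphM /= map_mpolyC.
rewrite [map_mpoly _ _]rmorphXn /= rmorphB /=.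
rewrite map_mpoly_Y3 map_mpoly_Z3 exprMn -rmorphXn /= mpolyCM -!mulrA; congr (_ * _).
rewrite mulrCA -exprD subnK //.
by rewrite -ltnS (ltn_predK (ltn_ord i)).
Qed.

Lemma homogenized_monic_size (m : {poly F}) :
  m \is monic -> homogenized m \is monic /\ size (homogenized m) = size m.
Proof.
move=> mm; have sm : (0 < size m)%N by rewrite size_poly_gt0 monic_neq0.
have top : (homogenized m)`_(size m).-1 = 1.
  rewrite coef_poly prednK // leqnn subnn expr0 mulr1.
  by move/monicP: mm; rewrite /lead_coef => ->.
have sh : size (homogenized m) = size m.
  apply/eqP; rewrite eqn_leq size_poly /= -(prednK sm) ltnNge.
  apply/negP => /leq_sizeP/(_ _ (leqnn _)) /eqP.
  by rewrite top oner_eq0.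
by rewrite monicE /lead_coef sh top.
Qed.

(** The coefficients of [homogenized m] do not involve x, so [upoly] undoes the evaluation at x -
    z. *)
Lemma upoly_homogenized (m : {poly F}) :
  upoly (homogenized m).[X3 F - Z3 F] = homogenized m.
Proof.
rewrite horner_poly rmorph_sum /homogenized poly_def; apply: eq_bigr => i _ /=.
rewrite !rmorphM !rmorphXn !rmorphB /= upolyC upolyX3 upolyY3 upolyZ3 addrK.
by rewrite -mul_polyC !rmorphM rmorphXn rmorphB.
Qed.


(* Divide by the homogenized minimal polynomial, which is monic in [x - z]: the coefficients
   of the remainder give F-linear relations between 1, a, ..., a ^+ (size m).-2. *)
Lemma homogenized_dvd (m : {poly F}) (p : {mpoly F[3]}) :
  m \is monic -> root (map_poly iota m) a ->
  (forall r : {poly F}, (size r < size m)%N -> root (map_poly iota r) a -> r = 0) ->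
  restr a p^iota = 0 -> exists r, p = r * (homogenized m).[X3 F - Z3 F].
Proof.
move=> mm rm min rp; pose N := homogenized m.
have [mN sN] := homogenized_monic_size mm; rewrite -/N in mN sN.
have e := Pdiv.RingMonic.rdivp_eq mN (upoly p).
set rem := Pdiv.Ring.rmodp (upoly p) N in e.
suff rem0 : rem = 0.
  exists (Pdiv.Ring.rdivp (upoly p) N).[X3 F - Z3 F].
  by rewrite -{1}[p]horner_upoly {1}e rem0 addr0 hornerM.
have srem : (size rem < size m)%N.
  by rewrite -sN Pdiv.Ring.ltn_rmodpN0 ?monic_neq0.
pose g i := rem`_i * (Y3 F - Z3 F) ^+ i.
have sum0 : \sum_(i < size rem) (a ^+ i)%:MP * (g i)^iota = 0.
  move: rp; rewrite /restr -map_upoly e rmorphD rmorphM /= hornerD hornerM.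
  rewrite homogenized_root // mulr0 add0r (@horner_coef_wide _ (size rem)) ?size_poly //.
  move=> e0; rewrite -[RHS]e0.
  apply: eq_bigr => i _; rewrite coef_map /g [map_mpoly _ _]rmorphM /=.
  rewrite [map_mpoly _ (_ ^+ _)]rmorphXn /= rmorphB /=.
  by rewrite map_mpoly_Y3 map_mpoly_Z3 exprMn -rmorphXn /= mulrCA.
have g0 i : (i < size rem)%N -> g i = 0.
  move=> lti; apply/mpolyP => mu; rewrite mcoeff0.
  pose r : {poly F} := \poly_(i < size rem) (g i)@_mu.
  have : r = 0.
    apply: min; first exact: leq_ltn_trans (size_poly _ _) srem.
    rewrite /root (@horner_coef_wide _ (size rem)); last first.
      by rewrite (leq_trans (size_poly _ _)) // size_poly.
    have := congr1 (mcoeff mu) sum0; rewrite raddf_sum mcoeff0 /= => e0.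
    rewrite -[X in _ == X]e0; apply/eqP/eq_bigr => j _.
    by rewrite coef_map coef_poly ltn_ord mcoeffCM mcoeff_map_mpoly mulrC.
  by move/(congr1 (fun s : {poly F} => s`_i)); rewrite coef_poly lti coef0.
apply/polyP => i; rewrite coef0; have [le|lt] := leqP (size rem) i; first exact: nth_default.
have /eqP := g0 i lt; rewrite mulf_eq0 expf_eq0 (negPf (Y3_sub_Z3_neq0 F)) andbF orbF.
by move/eqP.
Qed.

Lemma not_relatively_prime (f : {poly F}) (p q : {mpoly F[3]}) :
  f != 0 -> root (map_poly iota f) a ->
  restr a p^iota = 0 -> restr a q^iota = 0 -> ~ relatively_prime p q.
Proof.
move=> nzf rf rp rq; have [m [mm rm min]] := exists_minpoly nzf rf.
have [p' ep] := homogenized_dvd mm rm min rp.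
have [q' eq] := homogenized_dvd mm rm min rq.
move=> /(_ _ _ _ ep eq)[c eN].
(* If the common factor were constant, [homogenized m] would have size at most 1, whereas m has a
   root and so size at least 2. *)
have := upoly_homogenized m; rewrite eN upolyC => e.
have [_] := homogenized_monic_size mm; rewrite -e size_polyC => sm.
have := root_size_gt1 _ rm; rewrite map_poly_eq0 monic_neq0 // size_map_poly -sm.
by case: (_ != _) => /(_ isT).
Qed.

End Descent.

(** * Power sums and their quotients in characteristic two *)

Section CharacteristicTwo.
Variables (K : fieldType) (char2 : 2%N \in [pchar K]).
Local Notation R := {mpoly K[3]}.
Local Notation psi j := (phi ('X^j : {poly K})).
Local Notation comp := (@pihomog 3 K mdeg).

Let char2R : 2%N \in [pchar R]. Proof. by rewrite pchar_lalg. Qed.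

(** Brings identities modulo 2 within reach of [ring], by exhibiting the excess as a double. *)
Lemma eq_mod2 (x y w : R) : x = y + (w + w) -> x = y.
Proof. by rewrite (addrr_pchar2 char2R) addr0. Qed.

Definition power_sum4 (j : nat) : R :=
  X3 K ^+ j + Y3 K ^+ j + Z3 K ^+ j + (X3 K + Y3 K + Z3 K) ^+ j.

(** The lines of 0 and 1 are x - z and x - y; the factor y - z corresponds to the slope infinity. *)
Lemma phi_denE : phi_den K = line 0 * line 1 * (Y3 K - Z3 K).
Proof.
rewrite /phi_den /line mpolyC0 mpolyC1 mul0r mul1r subr0.
rewrite !(GRing.subr_pchar2 char2R).
apply: (eq_mod2 (w := - (Z3 K * (X3 K + Z3 K) * (Y3 K + Z3 K)))); ring.
Qed.

Lemma phi_den_neq0 : phi_den K != 0.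
Proof. by rewrite phi_denE !mulf_neq0 ?line_neq0 ?Y3_sub_Z3_neq0. Qed.

Lemma phi_num_sum (f : {poly K}) : phi_num f = \sum_(j < size f) f`_j *: power_sum4 j.
Proof.
rewrite /phi_num /subst3 !horner_coef !size_map_poly -!big_split /=.
by apply: eq_bigr => j _; rewrite !coef_map /= /power_sum4 !scalerDr !mul_mpolyC.
Qed.

Lemma phiXn j : psi j * phi_den K = power_sum4 j.
Proof.
by rewrite phiP // /phi_num /subst3 !map_polyXn !hornerXn.
Qed.

Lemma var_homog (i : 'I_3) : ('X_i : R) \is 1.-homog.
Proof. by rewrite dhomogX /= mdeg1. Qed.

Lemma power_sum4_homog j : power_sum4 j \is j.-homog.
Proof.
have h (p : R) : p \is 1.-homog -> p ^+ j \is j.-homog.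
  by move=> hp; have := dhomogMn j hp; rewrite mul1n.
by rewrite /power_sum4 !dhomogD // h // ?dhomogD // ?var_homog // dhomogD // var_homog.
Qed.

Lemma phi_den_homog : phi_den K \is 3.-homog.
Proof.
have h (i j : 'I_3) : ('X_i + 'X_j : R) \is 1.-homog by rewrite dhomogD // var_homog.
exact: dhomogM (dhomogM (h _ _) (h _ _)) (h _ _).
Qed.

(** The denominator is a form of degree 3, so multiplying by it shifts degrees by 3 and leaves the
    decomposition of [phi_num f] into power sums. *)
Lemma pihomog_phi (f : {poly K}) d : comp d (phi f) = f`_(d + 3) *: psi (d + 3).
Proof.
apply: (mulIf phi_den_neq0).
rewrite -(pihomogM_homog _ _ phi_den_homog) phiP // -scalerAl phiXn phi_num_sum.
rewrite raddf_sum /=.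
under eq_bigr => j _ do rewrite linearZ /= (pihomog_homog _ (power_sum4_homog j)).
have [lt|le] := ltnP (d + 3) (size f).
  rewrite (bigD1 (Ordinal lt)) //= eqxx big1 ?addr0 // => i.
  by rewrite -val_eqE eq_sym /= => /negPf ->; rewrite scaler0.
rewrite nth_default // scale0r big1 // => i _.
by rewrite gtn_eqF ?scaler0 // (leq_trans (ltn_ord i)).
Qed.

Lemma power_sum4_double j : power_sum4 (j.*2) = power_sum4 j ^+ 2.
Proof.
rewrite /power_sum4 -muln2 !exprM.
by rewrite !(exprDn_pchar _ _ (_ : [pchar R].-nat 2)) ?pnatE.
Qed.

(** By Frobenius the numerator is a square, and only one of its two factors [phi_den K] is divided
    out. *)
Lemma phiX_double j : psi j.*2 = psi j ^+ 2 * phi_den K.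
Proof.
apply: (mulIf phi_den_neq0); rewrite phiXn power_sum4_double -phiXn; ring.
Qed.

(** These are the Gold exponents. Raising to the power 2^e is additive, so expanding (x + y +
    z)^(2^e) (x + y + z) leaves only the mixed terms. *)
Lemma power_sum4_gold e : power_sum4 (2 ^ e + 1) =
  (Y3 K - Z3 K) * (X3 K - Z3 K) ^+ (2 ^ e) - (Y3 K - Z3 K) ^+ (2 ^ e) * (X3 K - Z3 K).
Proof.
rewrite /power_sum4 !addn1 !exprSr.
have n2 : [pchar R].-nat (2 ^ e)%N by rewrite pnatX pnatE //= char2R.
rewrite !(GRing.subr_pchar2 char2R) !(exprDn_pchar _ _ n2).
apply: (eq_mod2 (w := X3 K ^+ (2 ^ e) * X3 K + Y3 K ^+ (2 ^ e) * Y3 K)); ring.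
Qed.

Lemma restr_den a : a != 0 -> a != 1 -> restr a (phi_den K) != 0.
Proof.
move=> a0 a1; rewrite phi_denE !rmorphM /= !mulf_eq0 !negb_or !restr_line_eq0 a0 a1 /=.
by rewrite rmorphB /= restrY3 restrZ3 Y3_sub_Z3_neq0.
Qed.

Lemma restr_phiXn a j : a != 0 -> a != 1 -> restr a (power_sum4 j) = 0 -> restr a (psi j) = 0.
Proof.
move=> a0 a1; rewrite -phiXn rmorphM /= => /eqP.
by rewrite mulf_eq0 (negPf (restr_den a0 a1)) orbF => /eqP.
Qed.

(** With Q = 2^e, the numerator restricts to (a^Q - a) (y - z)^(Q + 1), up to sign, while the
    denominator does not vanish on this line. *)
Lemma restr_gold a e : a != 0 -> a != 1 -> a ^+ (2 ^ e) = a -> restr a (psi (2 ^ e + 1)) = 0.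
Proof.
move=> a0 a1 ae; apply: restr_phiXn => //; rewrite power_sum4_gold.
rewrite !(rmorphB, rmorphM, rmorphXn) /= restrX3 restrY3 restrZ3 addrK exprMn.
rewrite -rmorphXn /= ae; ring.
Qed.

End CharacteristicTwo.

(** The denominator is nonzero and compatible with base change, so comparing numerators suffices. *)
Lemma map_phi (F K : fieldType) (iota : {rmorphism F -> K}) (f : {poly F}) :
  2%N \in [pchar F] -> map_mpoly iota (phi f) = phi (map_poly iota f).
Proof.
move=> cF; have cK : 2%N \in [pchar K] by rewrite (fmorph_pchar iota).
apply: (mulIf (phi_den_neq0 cK)); rewrite phiP //.
have -> : phi_den K = map_mpoly iota (phi_den F).
  by rewrite /phi_den !rmorphM !rmorphD /= map_mpoly_X3 map_mpoly_Y3 map_mpoly_Z3.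
rewrite -rmorphM /= phiP // !phi_num_sum raddf_sum size_map_poly.
apply: eq_bigr => j _; rewrite coef_map /= map_mpolyZ /power_sum4.
by rewrite !rmorphD !rmorphXn !rmorphD /= map_mpoly_X3 map_mpoly_Y3 map_mpoly_Z3.
Qed.

(** * Degrees of units and of leading forms *)

Section MpolyUnits.
Variables (n : nat) (K : fieldType).
Implicit Types p q : {mpoly K[n]}.

Lemma unit_msizeE p : (p \is a GRing.unit) = (msize p == 1%N).
Proof.
apply/idP/msize_poly1P => [/unitrP[q [_ pq1]]|[c nzc ->]]; last first.
  by rewrite rmorph_unit ?unitfE.
apply/msize_poly1P; have nz : p * q != 0 by rewrite pq1 oner_eq0.
have [nzp nzq] : p != 0 /\ q != 0 by apply/andP; rewrite -negb_or -mulf_eq0.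
have := msizeM nzp nzq; rewrite pq1 msize1 (mpolySpred _ nzp) (mpolySpred _ nzq); lia.
Qed.

Lemma msize_pihomog_lead p : p != 0 -> msize (pihomog mdeg (msize p).-1 p) = msize p.
Proof.
move=> nz; apply/eqP; rewrite eqn_leq.
rewrite (leq_trans (msize_pihomog _ _)) ?prednK -?(mpolySpred _ nz) //=; last first.
  by rewrite lt0n msize_poly_eq0.
rewrite -(mlead_deg nz); apply: msize_mdeg_lt.
by rewrite mcoeff_msupp mcoeff_pihomog eqxx mleadc_eq0.
Qed.

End MpolyUnits.

(** * Factorization into lines at Gold exponents *)

Section GoldFactors.
Variables (K : closedFieldType) (char2 : 2%N \in [pchar K]).
Local Notation R := {mpoly K[3]}.
Local Notation psi j := (phi ('X^j : {poly K})).

(** For q = 2^e, the numerator is y - z times the lines of all roots of X^q - X; the denominator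
    removes y - z and the lines of 0 and 1. *)
Lemma phi_gold e : (0 < e)%N -> exists s : seq K,
  [/\ uniq s, psi (2 ^ e + 1) = lines s &
      forall a, (a \in s) = [&& a ^+ (2 ^ e) == a, a != 0 & a != 1]].
Proof.
move=> e0; set q := (2 ^ e)%N; pose p : {poly K} := 'X^q - 'X.
have q1 : (1 < q)%N by rewrite -(expn0 2) ltn_exp2l.
have sp : size p = q.+1 by rewrite size_polyDl size_polyXn // size_polyN size_polyX.
have lp : lead_coef p = 1.
  by rewrite /lead_coef sp coefB coefXn coefX eqxx gtn_eqF // subr0.
have [r] := closed_field_poly_normal p; rewrite lp scale1r => ep.
have rE a : (a \in r) = (a ^+ q == a).
  by rewrite -root_prod_XsubC -ep /root !hornerE subr_eq0.
(* X^q - X is separable because its derivative is -1. *)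
have ur : uniq r.
  rewrite -separable_prod_XsubC -ep separable_poly.unlock derivB derivXn derivX.
  rewrite -scaler_nat natrX (pcharf0 char2) expr0n gtn_eqF // scale0r sub0r.
  by rewrite -scaleN1r coprimepZr ?oppr_eq0 ?oner_eq0 // coprimep1.
have sr : size r = q by apply: succn_inj; rewrite -sp ep size_prod_XsubC.
have lr := lines_root_expX q1 ur sr (fun a ar => eqP (etrans (esym (rE a)) ar)).
have r0 : 0 \in r by rewrite rE expr0n gtn_eqF // ltnW.
have r1 : 1 \in rem 0 r by rewrite mem_rem_uniq // inE oner_eq0 rE expr1n eqxx.
exists (rem 1 (rem 0 r)); split; first by rewrite !rem_uniq.
  apply: (mulIf (phi_den_neq0 char2)); rewrite phiXn // power_sum4_gold // phi_denE //.
  transitivity (lines r * (Y3 K - Z3 K)).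
    have ev : (Y3 K - Z3 K) ^+ q = (Y3 K - Z3 K) ^+ q.-1 * (Y3 K - Z3 K).
      by rewrite -exprSr prednK // ltnW.
    by rewrite lr ev; ring.
  by rewrite (lines_rem r0) (lines_rem r1); ring.
move=> a; rewrite mem_rem_uniq ?rem_uniq // inE mem_rem_uniq // inE rE.
by case: (a ^+ q == a) (a == 0) (a == 1) => [] [] [].
Qed.

Lemma phiXn_small j : (j < 3)%N -> psi j = 0.
Proof.
move=> j3; apply: (mulIf (phi_den_neq0 char2)); rewrite phiXn // mul0r /power_sum4.
case: j j3 => [|[|[|//]]] _.
- by apply: (eq_mod2 char2 (w := 1 + 1)); ring.
- by apply: (eq_mod2 char2 (w := X3 K + Y3 K + Z3 K)); ring.
apply: (eq_mod2 char2 (w := X3 K ^+ 2 + Y3 K ^+ 2 + Z3 K ^+ 2 + X3 K * Y3 K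
  + X3 K * Z3 K + Y3 K * Z3 K)); ring.
Qed.

(** Let A be the factor containing the line of w. On this line c B vanishes but B does not, so c =
    0. Then c' A = g P is nonzero and vanishes on x = y, a line which does not divide A. *)
Lemma no_constant_perturbation (s : seq K) (w c c' g : K) (A B P : R) :
  uniq s -> w \in s -> 1 \notin s -> A * B = lines s ->
  restr w P = 0 -> restr 1 P = 0 -> g *: P != 0 ->
  A * c'%:MP + c%:MP * B <> g *: P.
Proof.
(* The claim is symmetric under exchanging A, c' with B, c. *)
wlog wA : A B c c' / restr w A = 0.
  move=> H us ws s1 eAB wP P1 nz e.
  have /eqP : restr w A * restr w B = 0.
    by rewrite -rmorphM /= eAB; apply/eqP; rewrite restr_lines_eq0.
  rewrite mulf_eq0 => /orP[] /eqP w0; first exact: (H A B c c').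
  apply: (H B A c' c) => //; first by rewrite mulrC.
  by rewrite -e; ring.
move=> us ws s1 eAB wP P1 nz e.
have wB : restr w B != 0.
  have [A' eA] := (line_dvdP w A).1 wA.
  have eA'B : A' * B = lines (rem w s).
    apply: (mulIf (line_neq0 w)); rewrite mulrAC -eA eAB.
    by rewrite (lines_rem ws) mulrC.
  have : restr w (lines (rem w s)) != 0 by rewrite restr_lines_eq0 mem_rem_uniq // inE eqxx.
  by rewrite -eA'B rmorphM /= mulf_eq0 negb_or => /andP[].
have c0 : c = 0.
  have := congr1 (restr w) e; rewrite -mul_mpolyC !(rmorphD, rmorphM) /=.
  rewrite wA wP !restrC mul0r add0r mulr0 => /eqP.
  by rewrite mulf_eq0 (negPf wB) orbF mpolyC_eq0 => /eqP.
move: e; rewrite c0 mpolyC0 mul0r addr0 => e.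
have c'0 : c' != 0 by apply: contra_neq nz => c'0; rewrite -e c'0 mpolyC0 mulr0.
have := congr1 (restr 1) e; rewrite -mul_mpolyC !rmorphM /= P1 mulr0 restrC => /eqP.
rewrite mulf_eq0 mpolyC_eq0 (negPf c'0) orbF => /eqP A1.
by move: s1; rewrite -restr_lines_eq0 -eAB rmorphM /= A1 mul0r eqxx.
Qed.

End GoldFactors.

(** A root of X^2 + X + 1 lies in F_4, hence is fixed by every power of exponent 4^i. *)
Lemma exists_cube_root (K : closedFieldType) : 2%N \in [pchar K] ->
  exists w : K, [/\ w != 0, w != 1 & forall i, w ^+ (2 ^ (2 * i)) = w].
Proof.
move=> char2; pose p : {poly K} := 'X^2 + ('X + 1%:P).
have sp : size p = 3.
  by rewrite size_polyDl size_polyXn // size_polyDl size_polyX // size_polyC oner_eq0.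
have /closed_rootP[w] : size p != 1%N by rewrite sp.
rewrite /root !hornerD hornerXn hornerX hornerC => /eqP ew; exists w; split.
- by apply: contra_eq_neq ew => ->; rewrite expr0n !add0r oner_eq0.
- apply: contra_eq_neq ew => ->.
  by rewrite expr1n (addrr_pchar2 char2) addr0 oner_eq0.
have w4 : w ^+ 4 = w.
  have -> : w ^+ 4 = w + (w ^+ 2 + (w + 1)) * (w ^+ 2 - w) by ring.
  by rewrite ew mul0r addr0.
elim=> [|i IH]; first by rewrite muln0 expr1.
by rewrite mulnS expnD exprM w4.
Qed.

(** * Irreducibility over an algebraically closed field *)

Section Irreducibility.
Variables (K : closedFieldType) (char2 : 2%N \in [pchar K]).
Variables (k m : nat) (f : {poly K}).
Local Notation R := {mpoly K[3]}.
Local Notation psi j := (phi ('X^j : {poly K})).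
Local Notation comp := (@pihomog 3 K mdeg).

(* [m] is the degree of the second nonzero form of [phi f]: half of the total degree. *)
Hypotheses (k_gt1 : (1 < k)%N) (def_m : (m + 3 = 2 ^ (2 * k - 1) + 2)%N).
Hypothesis f_lead : f`_(2 ^ (2 * k) + 1) = 1.
Hypothesis f_large : forall j, (2 ^ (2 * k) + 1 < j)%N -> f`_j = 0.
Hypothesis f_gap : forall j, (m + 3 < j < 2 ^ (2 * k) + 1)%N -> f`_j = 0.
Hypothesis f_second : f`_(m + 3) != 0.
Hypothesis f_coprime : exists2 j, f`_j != 0 &
  forall a, a ^+ (2 ^ (2 * k)) = a -> a != 0 -> a != 1 -> restr a (psi j) != 0.

Let gold_m : (2 ^ (2 * k) + 1 = m.*2 + 3)%N.
Proof.
have -> : (2 * k = (2 * k - 1).+1)%N by lia.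
rewrite expnS; lia.
Qed.

(** Through [phiX_double], this relates the second form to a smaller Gold exponent. *)
Let second_half : (m + 3 = (2 ^ (2 * (k - 1)) + 1).*2)%N.
Proof.
rewrite def_m; have -> : (2 * k - 1 = (2 * (k - 1)).+1)%N by lia.
rewrite expnS; lia.
Qed.

Let m_gt0 : (0 < m)%N.
Proof.
have : (2 ^ 2 <= 2 ^ (2 * (k - 1)))%N by rewrite leq_exp2l //; lia.
lia.
Qed.

Lemma pihomog_phi_top : comp m.*2 (phi f) = psi (2 ^ (2 * k) + 1).
Proof. by rewrite pihomog_phi // -gold_m f_lead scale1r. Qed.

Lemma pihomog_phi_gap d : (m < d < m.*2)%N -> comp d (phi f) = 0.
Proof. by move=> dm; rewrite pihomog_phi // f_gap ?scale0r //; lia. Qed.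

Lemma msize_phi : msize (phi f) = m.*2.+1.
Proof.
have top0 : comp m.*2 (phi f) != 0.
  have e0 : (0 < 2 * k)%N by lia.
  by rewrite pihomog_phi_top; have [s [_ -> _]] := phi_gold char2 e0; apply: lines_neq0.
have nz : phi f != 0 by apply: contra_neq top0 => ->; rewrite raddf0.
apply/eqP; rewrite eqn_leq; apply/andP; split; last first.
  by rewrite ltnNge; apply: contra_neqN top0 => /pihomog_msize ->.
rewrite (mpolySpred _ nz) ltnS leqNgt; apply: contra_neqN (pihomog_lead_neq0 nz) => lt.
by rewrite pihomog_phi // f_large ?scale0r // gold_m ltn_add2r.
Qed.

Lemma factor_unit (P Q : R) :
  phi f = P * Q -> (msize Q <= msize P)%N -> Q \is a GRing.unit.
Proof.
move=> ePQ leQP; have e0 : (0 < 2 * k)%N by lia.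
have [s [us eG sE]] := phi_gold char2 e0.
have nz : P * Q != 0 by rewrite -ePQ -msize_poly_eq0 msize_phi.
have [nzP nzQ] : P != 0 /\ Q != 0 by apply/andP; rewrite -negb_or -mulf_eq0.
have [S sP] : exists S, msize P = S.+1 by exists (msize P).-1; apply: mpolySpred.
have [T sQ] : exists T, msize Q = T.+1 by exists (msize Q).-1; apply: mpolySpred.
have ST : (S + T = m.*2)%N.
  by have := msizeM nzP nzQ; rewrite -ePQ msize_phi sP sQ; lia.
have TS : (T <= S)%N by move: leQP; rewrite sP sQ.
pose p := top_down S P; pose q := top_down T Q.
have pqE i : (i <= m.*2)%N -> (p * q)`_i = comp (m.*2 - i) (phi f).
  by move=> im; rewrite coef_top_downM ?sP ?sQ ?ST // ePQ.
have pE i : p`_i = if (i < S.+1)%N then comp (S - i) P else 0 by rewrite coef_poly.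
have qE i : q`_i = if (i < T.+1)%N then comp (T - i) Q else 0 by rewrite coef_poly.
have sp0 : msize p`_0 = S.+1 by rewrite pE /= subn0 -sP -(msize_pihomog_lead nzP) sP.
have sq0 : msize q`_0 = T.+1 by rewrite qE /= subn0 -sQ -(msize_pihomog_lead nzQ) sQ.
have e00 : p`_0 * q`_0 = lines s.
  by rewrite -coef0M pqE // subn0 pihomog_phi_top eG.
(* The indices 0 < i < m stand for the degrees strictly between m and 2m, where [phi f] has no
   form. *)
have gap := lines_gap us e00 (m := m).
have {}gap i : (0 < i < m)%N -> p`_i = 0 /\ q`_i = 0.
  apply: gap => {}i => [i0|im]; last by rewrite pqE ?pihomog_phi_gap //; lia.
  rewrite sp0 pE; case: ltnP => [lt _|_ /eqP//].
  by rewrite ltnS (leq_trans (msize_pihomog _ _)) //; lia.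
rewrite unit_msizeE sQ eqSS; apply/negPn/negP; rewrite -lt0n => T0.
have [Tm|mT] := ltnP T m.
  (* All lower forms of Q, down to its constant term, lie in the gap. *)
  have qC : q = (q`_0)%:P.
    apply/polyP => i; rewrite coefC; case: eqP => [->//|/eqP].
    rewrite -lt0n => i0; rewrite qE; case: ltnP => // iT.
    by have [|_] := gap i; [rewrite i0 (leq_trans iT) | rewrite qE iT].
  have [[a as_ qa]|] := lines_factor (etrans (mulrC _ _) e00); last first.
    by rewrite unit_msizeE sq0 eqSS => /eqP T00; rewrite T00 in T0.
  have [j fj] := f_coprime; move: as_; rewrite sE => /and3P[/eqP aq a0 a1].
  move=> /(_ a aq a0 a1) /eqP; apply.
  (* Below 3 the degree j - 3 would truncate, but there [psi j] is zero. *)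
  have [j3|j3] := ltnP j 3; first by rewrite phiXn_small // rmorph0.
  have jm : (j - 3 <= m.*2)%N.
    rewrite leqNgt; apply: contra_neqN fj => lt; apply: f_large.
    by rewrite gold_m addnC -ltn_subRL.
  (* Counting downwards from 2m, this index is that of the form of degree j - 3, a multiple of the
     leading form of Q. *)
  have := pqE (m.*2 - (j - 3))%N (leq_subr _ _).
  rewrite subKn // pihomog_phi // subnK // qC coefMC => /(congr1 (restr a)).
  rewrite -mul_mpolyC !rmorphM /= qa mulr0 restrC => /eqP.
  by rewrite eq_sym mulf_eq0 mpolyC_eq0 (negPf fj) => /eqP.
have [Tm Sm] : T = m /\ S = m by lia.
have := pqE m; rewrite -addnn leq_addr addnK => /(_ isT).
rewrite pihomog_phi // coefM_gap //; last by move=> i im; left; case: (gap i im).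
(* Index m is the last one for both factors, so it carries their constant terms. *)
have pm : p`_m = (p`_m@_0)%:MP.
  by apply: msize1_polyC; rewrite pE Sm ltnSn subnn msize_pihomog.
have qm : q`_m = (q`_m@_0)%:MP.
  by apply: msize1_polyC; rewrite qE Tm ltnSn subnn msize_pihomog.
rewrite pm qm.
have [w [w0 w1 ww]] := exists_cube_root char2.
have w_s : w \in s by rewrite sE ww eqxx w0.
(* The line x = y was cancelled against the denominator, but [phiX_double] puts it into the second
   form. *)
have s1 : 1 \notin s by rewrite sE eqxx !andbF.
have := phiX_double char2 (2 ^ (2 * (k - 1)) + 1); rewrite -second_half => psiE.
apply: (no_constant_perturbation us w_s s1 e00).
- by rewrite psiE rmorphM rmorphXn /= restr_gold // expr0n mul0r.
- by rewrite psiE phi_denE // !rmorphM /= restr_lineK mulr0 mul0r mulr0.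
rewrite -mul_mpolyC mulf_neq0 ?mpolyC_eq0 // psiE mulf_neq0 ?phi_den_neq0 //.
have e1 : (0 < 2 * (k - 1))%N by rewrite muln_gt0 subn_gt0.
by have [s' [_ -> _]] := phi_gold char2 e1; rewrite expf_neq0 // lines_neq0.
Qed.

Lemma phi_irreducible : irreducible_elt (phi f).
Proof.
split=> [||a b e].
- by rewrite -msize_poly_eq0 msize_phi.
- by rewrite unit_msizeE msize_phi eqSS -lt0n double_gt0.
have [le|/ltnW le] := leqP (msize b) (msize a); first by right; exact (factor_unit e le).
by left; apply: (factor_unit _ le); rewrite e mulrC.
Qed.

End Irreducibility.

Theorem theorem12 (n : nat) (L : finFieldType) (k : nat) (f h : {poly L}) :
  (0 < n)%N -> #|L| = (2 ^ n)%N -> (2 <= k)%N ->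
  f = 'X^(2 ^ (2 * k) + 1) + h ->
  size h = (2 ^ (2 * k - 1) + 2).+1 ->
  (exists j : nat,
     h`_j != 0 /\ relatively_prime (phi_mono (2 ^ (2 * k) + 1)) (phi_mono j)) ->
  absolutely_irreducible (phi f).
Proof.
move=> n0 cardL k2 ef sh [j [hj rel]] Lbar iota _.
have cL : 2%N \in [pchar L] := card_finPcharP cardL isT.
have cK : 2%N \in [pchar Lbar] by rewrite (fmorph_pchar iota).
pose q := (2 ^ (2 * k))%N.
have q2 : q = (2 * 2 ^ (2 * k - 1))%N by rewrite -expnS /q; congr (_ ^ _)%N; lia.
have h3 : (3 < 2 ^ (2 * k - 1))%N.
  by apply: (@leq_trans (2 ^ 2)) => //; rewrite leq_exp2l //; lia.
rewrite map_phi //.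
have fE i : (map_poly iota f)`_i = (i == q + 1)%:R + iota h`_i.
  by rewrite coef_map ef coefD coefXn /= rmorphD rmorph_nat.
have h0 i : (2 ^ (2 * k - 1) + 2 < i)%N -> h`_i = 0 by move=> lt; rewrite nth_default // sh.
(* With m = 2^(2k-1) - 1, the index m + 3 is the degree of [h]. *)
apply: (@phi_irreducible _ cK k (2 ^ (2 * k - 1) - 1)) => //; rewrite -?/q.
- lia.
- by rewrite fE eqxx h0 ?rmorph0 ?addr0 //; lia.
- by move=> i lt; rewrite fE gtn_eqF // h0 ?rmorph0 ?addr0 //; lia.
- move=> i /andP[lt1 lt2]; rewrite fE ltn_eqF // h0 ?rmorph0 ?addr0 //; lia.
- rewrite fE ltn_eqF ?add0r ?fmorph_eq0; last by lia.
  have -> : (2 ^ (2 * k - 1) - 1 + 3 = (size h).-1)%N by lia.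
  by rewrite -/(lead_coef h) lead_coef_eq0 -size_poly_eq0 sh.
(* [j] is at most the degree of [h], hence below q + 1, so its coefficient in [f] comes from [h]
   alone. *)
exists j => [|a aq a0 a1].
  rewrite fE ltn_eqF ?add0r ?fmorph_eq0 // ltnNge.
  by apply: contra_neqN hj => jq; rewrite h0 //; lia.
apply/eqP => ra.
have iota2 : {rmorphism 'F_2 -> Lbar} :=
  GRing.in_alg (pPrimeCharType cK) : {rmorphism 'F_2 -> pPrimeCharType cK}.
have mono i : map_mpoly iota2 (phi_mono i) = phi 'X^i.
  by rewrite map_phi ?pchar_Fp // map_polyXn.
(* Being a root of X^q - X, [a] is algebraic over F_2, so a common line over the closure contradicts
   coprimality over F_2. *)
apply: (@not_relatively_prime _ _ iota2 a ('X^q - 'X)) rel; rewrite ?mono //.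
- rewrite -size_poly_eq0 size_polyDl size_polyXn // size_polyN size_polyX; lia.
- by rewrite rmorphB /= map_polyXn map_polyX /root !hornerE aq subrr.
exact: restr_gold.
Qed.
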